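(* Let $r|_{\mathcal I}\in\{0,1\}^s$ be the random string sampled by Alice in encryption, let $y\in\{0,1\}^s$ be Bob's measurement outcome in decryption, let $\hat x=\mathrm{corr}(y,q\oplus e)$ be Bob's corrected string, and let $F^{\mathrm{ec}}\in\{0,1\}$ be the flag that equals $1$ if and only if $H_{\mathrm{ec}}(\hat x)=p\oplus d$ (all as described in the context). Then $$\Pr\big[H_{\mathrm{pa}}(r|_{\mathcal I})\ne H_{\mathrm{pa}}(\hat x)\ \wedge\ F^{\mathrm{ec}}=1\big]\le\frac1{2^\tau}.$$
   Context: $\omega$ is Hamming weight; $x|_{\mathcal J}$ is the restriction of a string $x$ to the positions in $\mathcal J$. $\mathsf H$ is the one-qubit Hadamard operator, and for $r,\theta\in\{0,1\}^m$, $|r^\theta\rangle=\mathsf H^{\theta_1}|r_1\rangle\otimes\cdots\otimes\mathsf H^{\theta_m}|r_m\rangle$. A finite family $\mathfrak H$ of functions $\mathcal X\to\mathcal Z$ is universal$_2$ if for distinct $x,x'\in\mathcal X$ and $H$ uniform in $\mathfrak H$, $\Pr[H(x)=H(x')]\le 1/|\mathcal Z|$. Scheme. Let $n,s,k,\tau,\mu$ be positive integers with $\mu<s$, and $m=s+k$. Let $\Theta=\{\theta\in\{0,1\}^m:\omega(\theta)=k\}$; for $\theta\in\Theta$ put $\mathcal I=\{i:\theta_i=0\}$ (size $s$) and $\bar{\mathcal I}=\{i:\theta_i=1\}$ (size $k$). $\mathfrak H_{\mathrm{pa}}$ is a universal$_2$ family of functions $\{0,1\}^s\to\{0,1\}^n$,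 $\mathfrak H_{\mathrm{ec}}$ is a universal$_2$ family of functions $\{0,1\}^s\to\{0,1\}^\tau$; $\mathrm{synd}:\{0,1\}^s\to\{0,1\}^\mu$ and $\mathrm{corr}:\{0,1\}^s\times\{0,1\}^\mu\to\{0,1\}^s$ are the syndrome function and the string-correcting (syndrome decoding) function of a linear $[s,s-\mu]$ code. Key: sample independently and uniformly $\theta\in\Theta$, $r|_{\bar{\mathcal I}}\in\{0,1\}^k$, $u\in\{0,1\}^n$, $d\in\{0,1\}^\tau$, $e\in\{0,1\}^\mu$, $H_{\mathrm{pa}}\in\mathfrak H_{\mathrm{pa}}$, $H_{\mathrm{ec}}\in\mathfrak H_{\mathrm{ec}}$. Encryption (Alice) of a message $\mathrm{msg}\in\{0,1\}^n$: sample $r|_{\mathcal I}\in\{0,1\}^s$ uniformly (giving $r\in\{0,1\}^m$), and send the $m$-qubit state $|r^\theta\rangle\langle r^\theta|$ and the classical strings $c=\mathrm{msg}\oplus H_{\mathrm{pa}}(r|_{\mathcal I})\oplus u$, $p=H_{\mathrm{ec}}(r|_{\mathcal I})\oplus d$, $q=\mathrm{synd}(r|_{\mathcal I})\oplus e$. Transmission: the $m$-qubit state passes through an arbitrary noisy quantum channel (a CPTP map on $m$ qubits, not depending on the key), so that Bob receives some $m$-qubit state $\rho_B$ in place of $|r^\theta\rangle\langle r^\theta|$; the strings $c,p,q$ are received unaltered. Decryption (Bob, given the key): Bob measures the qubits of $\rho_B$ indexed by $\mathcal I$ in the computational basis, with outcome $y\in\{0,1\}^s$, and computes $\hat x=\mathrm{corr}(y,q\oplus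 e)$ and $F^{\mathrm{ec}}$. The probability is over the key, $r|_{\mathcal I}$ and the measurement outcome. *)

(* Defs.v *)
From HB Require Import structures.
From mathcomp Require Import all_boot all_order all_algebra.
From mathcomp Require Import complex reals.
Set Implicit Arguments.
Unset Strict Implicit.
Unset Printing Implicit Defensive.
Import Order.TTheory GRing.Theory Num.Theory.
Local Open Scope ring_scope.
Local Open Scope sesquilinear_scope.
Local Open Scope complex_scope.

(* A string in {0,1}^n is a row vector over F_2, so that XOR is [+]. *)
Notation bits n := 'rV['F_2]_n.

Definition weight n (x : bits n) : nat := #|[set i | x 0 i != 0]|.

Definition seq_of n (x : bits n) : seq 'F_2 := [seq x 0 i | i <- enum 'I_n].

(* x|_J as a string of length t, positions of J taken in increasing order.
   Only used with t = #|J|: the default value of [nth] is then irrelevant. *)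
Definition restr m t (J : {set 'I_m}) (x : bits m) : bits t :=
  \row_(j < t) nth 0 [seq x 0 i | i <- enum J] j.

Definition zeros m (theta : bits m) : {set 'I_m} := [set i | theta 0 i == 0].
Definition ones m (theta : bits m) : {set 'I_m} := [set i | theta 0 i != 0].

Definition Theta (s k : nat) := {theta : bits (s + k) | weight theta == k}.

(* The string r with r|_I = x and r|_Ibar = z, where I = zeros theta and
   Ibar = ones theta; see [restr_merge_zeros] and [restr_merge_ones]. *)
Definition merge_bits s k (theta : Theta s k) (x : bits s) (z : bits k) :
    bits (s + k) :=
  \row_i if val theta 0 i == 0
         then nth 0 (seq_of x) (index i (enum (zeros (val theta))))
         else nth 0 (seq_of z) (index i (enum (ones (val theta)))).

Lemma card_ones s k (theta : Theta s k) : #|ones (val theta)| = k.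
Proof. by case: theta => theta /= /eqP. Qed.

Lemma card_zeros s k (theta : Theta s k) : #|zeros (val theta)| = s.
Proof.
have := cardsC (ones (val theta)); rewrite card_ones card_ord addnC.
have -> : ~: ones (val theta) = zeros (val theta).
  by apply/setP => i; rewrite !inE negbK.
exact: addIn.
Qed.

Lemma restr_merge_aux m t (J : {set 'I_m}) (w : bits m) (x : bits t) :
  #|J| = t ->
  {in J, forall i, w 0 i = nth 0 (seq_of x) (index i (enum J))} ->
  restr t J w = x.
Proof.
move=> cJ wE; apply/rowP => j; rewrite mxE.
have szJ : size (enum J) = t by rewrite -cardE.
have jt : (j < size (enum J))%N by rewrite szJ.
have i0 : 'I_m by case: (enum J) jt => // a ? _; exact: a.
rewrite (nth_map i0) // wE; last by rewrite -mem_enum mem_nth.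
by rewrite index_uniq ?enum_uniq // (nth_map j) ?size_enum_ord // nth_ord_enum.
Qed.

Lemma restr_merge_zeros s k (theta : Theta s k) x z :
  restr s (zeros (val theta)) (merge_bits theta x z) = x.
Proof.
apply: restr_merge_aux; first exact: card_zeros.
by move=> i; rewrite inE mxE => ->.
Qed.

Lemma restr_merge_ones s k (theta : Theta s k) x z :
  restr k (ones (val theta)) (merge_bits theta x z) = z.
Proof.
apply: restr_merge_aux; first exact: card_ones.
by move=> i; rewrite inE mxE => /negPf ->.
Qed.

Definition uniform (R : realType) (T : finType) (_ : T) : R := #|T|%:R^-1.

Definition Pr (R : realType) (T : finType) (P : T -> R) (E : pred T) : R :=
  \sum_(t | E t) P t.

(* A finite family of functions X -> Z is given as h : J -> X -> Z. *)
Definition universal2 (R : realType) (J X Z : finType) (h : J -> X -> Z) :=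
  (0 < #|J|)%N /\
  forall x x' : X, x != x' ->
    Pr (@uniform R J) (fun j => h j x == h j x') <= #|Z|%:R^-1.

Definition parity_check s mu (C : {vspace bits s}) (H : 'M['F_2]_(mu, s)) :=
  forall x, (x \in C) = (x *m H^T == 0).

Definition syndrome s mu (H : 'M['F_2]_(mu, s)) (x : bits s) : bits mu :=
  x *m H^T.

(* A syndrome decoder assigns to every syndrome an error pattern having that
   syndrome (typically a minimum-weight one, but no rule is imposed).  Given
   the received string y and the syndrome z of the string sent, synd y + z is
   the syndrome of the error, whose assigned pattern is removed from y. *)
Definition error_patterns s mu (H : 'M['F_2]_(mu, s))
    (err : bits mu -> bits s) :=
  forall z, syndrome H (err z) = z.

Definition syndrome_decode s mu (H : 'M['F_2]_(mu, s))
    (err : bits mu -> bits s) (y : bits s) (z : bits mu) : bits s :=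
  y + err (syndrome H y + z).

(* Operators on m qubits are matrices whose rows and columns are indexed by
   {0,1}^m, through [enum_rank] and [enum_val]. *)
Definition qdim (m : nat) : nat := #|{: bits m}|.

Definition ket (R : realType) m (w : bits m) : 'cV[R[i]]_(qdim m) :=
  delta_mx (enum_rank w) 0.

Definition tensor (R : realType) m (v : 'I_m -> 'cV[R[i]]_2) :
    'cV[R[i]]_(qdim m) :=
  \col_a \prod_(i < m) v i ((enum_val a : bits m) 0 i) 0.

Definition hadamard (R : realType) : 'M[R[i]]_2 :=
  \matrix_(a, b) (((Num.sqrt 2)^-1)%:C * (-1) ^+ (a * b)).

Definition conj_coding (R : realType) m (r theta : bits m) :
    'cV[R[i]]_(qdim m) :=
  tensor (fun i => hadamard R ^+ (theta 0 i) *m delta_mx (r 0 i : 'I_2) 0).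

Definition density (R : realType) N (v : 'cV[R[i]]_N) : 'M[R[i]]_N :=
  v *m v ^t*.

(* Measuring the qubits of J in the computational basis. *)
Definition meas_proj (R : realType) m t (J : {set 'I_m}) (y : bits t) :
    'M[R[i]]_(qdim m) :=
  \sum_(w : bits m | restr t J w == y) density (ket R w).

Definition meas_prob (R : realType) m t (J : {set 'I_m})
    (rho : 'M[R[i]]_(qdim m)) (y : bits t) : R :=
  complex.Re (\tr (meas_proj R J y *m rho)).

(* [0 <= z] in R[i] entails that z is real. *)
Definition psd (R : realType) N (A : 'M[R[i]]_N) :=
  forall v : 'cV_N, 0 <= (v ^t* *m A *m v) 0 0.

(* id_d (x) Phi, acting on d x d block matrices with N x N blocks. *)
Definition ampliation (R : realType) N (Phi : 'M[R[i]]_N -> 'M[R[i]]_N) d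
    (A : 'M[R[i]]_(\sum_(a < d) N)) : 'M[R[i]]_(\sum_(a < d) N) :=
  \mxblock_(a < d, b < d) Phi (submxblock A a b).

Definition completely_positive (R : realType) N
    (Phi : 'M[R[i]]_N -> 'M[R[i]]_N) :=
  forall d (A : 'M[R[i]]_(\sum_(a < d) N)), psd A -> psd (ampliation Phi A).

Definition cptp (R : realType) N (Phi : {linear 'M[R[i]]_N -> 'M[R[i]]_N}) :=
  completely_positive Phi /\ forall A, \tr (Phi A) = \tr A.

Record key (s k n tau mu : nat) (Jpa Jec : finType) := Key {
  k_theta : Theta s k;
  k_r : bits k; (* r|_Ibar *)
  k_u : bits n;
  k_d : bits tau;
  k_e : bits mu;
  k_pa : Jpa;
  k_ec : Jec }.

Section KeyFinite.
Variables (s k n tau mu : nat) (Jpa Jec : finType).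

Definition tuple_of_key (K : key s k n tau mu Jpa Jec) :=
  (k_theta K, k_r K, k_u K, k_d K, k_e K, k_pa K, k_ec K).

Definition key_of_tuple x : key s k n tau mu Jpa Jec :=
  let: (theta, r, u, d, e, hpa, hec) := x in Key theta r u d e hpa hec.

Lemma tuple_of_keyK : cancel tuple_of_key key_of_tuple.
Proof. by case. Qed.

HB.instance Definition _ :=
  Finite.copy (key s k n tau mu Jpa Jec) (can_type tuple_of_keyK).
End KeyFinite.

Record ciphertext (R : realType) (m n tau mu : nat) := Ciphertext {
  ct_state : 'M[R[i]]_(qdim m);
  ct_c : bits n;
  ct_p : bits tau;
  ct_q : bits mu }.

(* x is the string r|_I sampled by Alice. *)
Definition encrypt (R : realType) s k n tau mu (Jpa Jec : finType)
    (Hpa : Jpa -> bits s -> bits n) (Hec : Jec -> bits s -> bits tau)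
    (synd : bits s -> bits mu) (K : key s k n tau mu Jpa Jec)
    (msg : bits n) (x : bits s) : ciphertext R (s + k) n tau mu :=
  {| ct_state :=
       density (conj_coding R (merge_bits (k_theta K) x (k_r K)) (val (k_theta K)));
     ct_c := msg + Hpa (k_pa K) x + k_u K;
     ct_p := Hec (k_ec K) x + k_d K;
     ct_q := synd x + k_e K |}.

Definition transmit (R : realType) m n tau mu
    (Phi : 'M[R[i]]_(qdim m) -> 'M[R[i]]_(qdim m))
    (ct : ciphertext R m n tau mu) : ciphertext R m n tau mu :=
  {| ct_state := Phi (ct_state ct);
     ct_c := ct_c ct; ct_p := ct_p ct; ct_q := ct_q ct |}.

Definition outcome_prob (R : realType) s k n tau mu (Jpa Jec : finType)
    (K : key s k n tau mu Jpa Jec) (ct : ciphertext R (s + k) n tau mu)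
    (y : bits s) : R :=
  meas_prob (zeros (val (k_theta K))) (ct_state ct) y.

Definition corrected (R : realType) s k n tau mu (Jpa Jec : finType)
    (corr : bits s -> bits mu -> bits s)
    (K : key s k n tau mu Jpa Jec) (ct : ciphertext R (s + k) n tau mu)
    (y : bits s) : bits s :=
  corr y (ct_q ct + k_e K).

Definition flag_ec (R : realType) s k n tau mu (Jpa Jec : finType)
    (Hec : Jec -> bits s -> bits tau) (corr : bits s -> bits mu -> bits s)
    (K : key s k n tau mu Jpa Jec) (ct : ciphertext R (s + k) n tau mu)
    (y : bits s) : bool :=
  Hec (k_ec K) (corrected corr K ct y) == ct_p ct + k_d K.

(* Joint distribution of the key, r|_I and the outcome y, where [ct K x] is the
   ciphertext received by Bob when the key is K and r|_I = x. *)
Definition run_distr (R : realType) s k n tau mu (Jpa Jec : finType)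
    (ct : key s k n tau mu Jpa Jec -> bits s -> ciphertext R (s + k) n tau mu)
    (t : key s k n tau mu Jpa Jec * bits s * bits s) : R :=
  let: (K, x, y) := t in
  uniform R K * uniform R x * outcome_prob K (ct K x) y.

(* Main.v *)
(** The pads [d] and [e] cancel, so Bob's string [xhat] depends only on [y] and
    on [synd x], and neither it nor the law of [y] depends on [H_ec].  Hence,
    conditionally on everything but [H_ec], the event forces a collision of
    [H_ec] at the fixed pair [xhat <> x], which has probability at most
    [2^-tau].  Quantum mechanics enters only through the fact that the outcomes
    [y] carry nonnegative weights summing to [1]. *)
Require Import Defs.
From HB Require Import structures.
From mathcomp Require Import all_boot all_order all_algebra.
From mathcomp Require Import complex reals ring.
Set Implicit Arguments.
Unset Strict Implicit.
Unset Printing Implicit Defensive.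
Import Order.TTheory GRing.Theory Num.Theory.
Local Open Scope ring_scope.
Local Open Scope sesquilinear_scope.
Local Open Scope complex_scope.

Lemma density_psd (R : realType) N (v : 'cV[R[i]]_N) : psd (density v).
Proof.
move=> u; rewrite /density mulmxA -mulmxA.
(* The quadratic form of [density v] at [u] is the squared modulus of the scalar [v ^t* *m u]. *)
have -> : u ^t* *m v = (v ^t* *m u) ^t*.
  by rewrite [in RHS]trmx_mul [in RHS]map_mxM trmxCK.
by rewrite mxE big_ord1 !mxE mulrC -normCK exprn_ge0.
Qed.

Lemma psd_diag (R : realType) N (A : 'M[R[i]]_N) i : psd A -> 0 <= A i i.
Proof.
move=> /(_ (delta_mx i 0)).
by rewrite trmx_delta map_delta_mx -rowE -colE !mxE.
Qed.

Lemma trC_mxcol (R : realType) p N (v : 'I_p -> 'cV[R[i]]_N) :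
  (\mxcol_(a < p) v a) ^t* = \mxrow_(a < p) (v a) ^t*.
Proof. by apply/matrixP => a b; rewrite !mxE. Qed.

(* Positivity of [Phi] is complete positivity with a one-dimensional ancilla,
   up to the identification of [\sum_(a < 1) N] with [N]. *)
Lemma cp_density_diag (R : realType) N (Phi : 'M[R[i]]_N -> 'M[R[i]]_N)
    (v : 'cV[R[i]]_N) i :
  completely_positive Phi -> 0 <= Phi (density v) i i.
Proof.
move=> PhiCP.
pose w : 'cV[R[i]]_(\sum_(a < 1) N) := \mxcol_(a < 1) v.
have wE : density w = \mxblock_(a < 1, b < 1) density v.
  by rewrite /density trC_mxcol mul_mxcol_mxrow.
have := PhiCP 1%N _ (density_psd w).
move=> /(psd_diag (tagnat.Rank 0 i)).
have -> (B : 'M[R[i]]_(\sum_(a < 1) N)) :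
  B (tagnat.Rank 0 i) (tagnat.Rank 0 i) = submxblock B 0 0 i i by rewrite mxE.
by rewrite mxblockK wE mxblockK.
Qed.

Lemma tr_density (R : realType) N (v : 'cV[R[i]]_N) :
  \tr (density v) = \sum_i `|v i 0| ^+ 2.
Proof. by apply: eq_bigr => i _; rewrite mxE big_ord1 !mxE normCK. Qed.

Lemma tr_density_tensor (R : realType) m (v : 'I_m -> 'cV[R[i]]_2) :
  \tr (density (tensor v)) = \prod_i \tr (density (v i)).
Proof.
under [RHS]eq_bigr do rewrite tr_density.
(* Expanding the product of sums gives one term per function ['I_m -> 'I_2], that is, per string. *)
rewrite bigA_distr_bigA tr_density (reindex enum_rank) /=; last first.
  by apply: onW_bij; exact: enum_rank_bij.
rewrite (reindex (fun f : {ffun 'I_m -> 'I_2} => (\row_i f i : bits m))) /=.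
  apply: eq_bigr => f _; rewrite mxE normr_prod -prodrXl.
  by apply: eq_bigr => i _; rewrite enum_rankK mxE.
exists (fun w : bits m => [ffun i => w 0 i]) => w _ /=.
  by apply/ffunP => i; rewrite ffunE mxE.
by apply/rowP => i; rewrite mxE ffunE.
Qed.

Lemma tr_conj_coding (R : realType) m (r theta : bits m) :
  \tr (density (conj_coding R r theta)) = 1.
Proof.
rewrite tr_density_tensor; apply: big1 => i _; rewrite tr_density.
rewrite -colE; set c : 'I_2 := r 0 i.
case: (theta 0 i) => [[|[|//]]] /= _.
  (* For [theta 0 i = 0] the factor is a basis vector; otherwise it is a Hadamard column, with two
     entries of squared modulus 1/2. *)
  rewrite expr0 (bigD1 c) //= big1 => [|j jc]; rewrite !mxE.
    by rewrite eqxx normr1 expr1n addr0.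
  by rewrite (negPf jc) normr0 expr0n.
under eq_bigr => j _ do rewrite expr1 !mxE normrM exprMn
  normrX normrN1 expr1n expr1n mulr1.
rewrite sumr_const card_ord normc_def /=.
rewrite expr0n addr0 -rmorphXn /= sqr_sqrtr ?sqr_ge0 // exprVn sqr_sqrtr ?ler0n //.
by rewrite -rmorphMn /= -mulr_natr mulVf ?pnatr_eq0.
Qed.

(* [complex.Re] is declared additive on [Rcomplex R] only, not on [R[i]]. *)
Lemma Re_sum (R : realType) (I : finType) (P : pred I) (F : I -> R[i]) :
  complex.Re (\sum_(i | P i) F i) = \sum_(i | P i) complex.Re (F i).
Proof. by apply: (big_morph (@complex.Re R)) => // -[? ?] [? ?]. Qed.

(** The Born rule in a basis where the projector is diagonal: only diagonal entries of [rho]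
    matter. *)
Lemma meas_probE (R : realType) m t (J : {set 'I_m})
    (rho : 'M[R[i]]_(qdim m)) (y : bits t) :
  meas_prob J rho y =
  \sum_(w : bits m | restr t J w == y)
     complex.Re (rho (enum_rank w) (enum_rank w)).
Proof.
rewrite /meas_prob /meas_proj mulmx_suml (raddf_sum (@mxtrace _ _)) Re_sum.
apply: eq_bigr => w _ /=; congr complex.Re.
rewrite /density -mulmxA mxtrace_mulC trmx_delta map_delta_mx -rowE -colE.
by rewrite /mxtrace big_ord1 !mxE.
Qed.

Lemma meas_prob_ge0 (R : realType) m t (J : {set 'I_m})
    (rho : 'M[R[i]]_(qdim m)) (y : bits t) :
  (forall a, 0 <= rho a a) -> 0 <= meas_prob J rho y.
Proof.
move=> rho0; rewrite meas_probE sumr_ge0 // => w _.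
by have := rho0 (enum_rank w); rewrite lecE => /andP[].
Qed.

(** Each basis string restricts to exactly one [y], so the outcomes partition the diagonal of
    [rho]. *)
Lemma sum_meas_prob (R : realType) m t (J : {set 'I_m})
    (rho : 'M[R[i]]_(qdim m)) :
  \sum_(y : bits t) meas_prob J rho y = complex.Re (\tr rho).
Proof.
under eq_bigr do rewrite meas_probE.
rewrite /mxtrace Re_sum [RHS](reindex enum_rank) /=; last first.
  by apply: onW_bij; exact: enum_rank_bij.
by rewrite [RHS](partition_big (restr t J) predT).
Qed.

Lemma card_bits t : #|{: bits t}| = (2 ^ t)%N.
Proof. by rewrite card_mx card_Fp // mul1n. Qed.

Lemma universal2_sum (R : realType) (J X Z : finType) (h : J -> X -> Z) x x' :
  universal2 R h -> x != x' ->
  \sum_(j | h j x == h j x') (1 : R) <= #|J|%:R / #|Z|%:R.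
Proof.
move=> [J0 hU] xx'; have := hU x x' xx'; rewrite /Pr /uniform.
rewrite !sumr_const -(mulr_natr _^-1).
by rewrite ler_pdivrMl ?ltr0n // mulr_natr.
Qed.

(** The averaging core: since [w] does not see [j], one may sum over [j] first with [a], [x], [y]
    fixed, then use that [w a x] has mass at most 1. *)
Lemma average_bound (R : realType) (A J X Y : finType) (w : A -> X -> Y -> R)
    (bad : A -> J -> X -> Y -> bool) (eps : R) :
  0 <= eps -> (forall a x y, 0 <= w a x y) ->
  (forall a x, \sum_y w a x y <= 1) ->
  (forall a x y, \sum_(j | bad a j x y) 1 <= #|J|%:R * eps) ->
  \sum_a \sum_j \sum_x \sum_(y | bad a j x y)
     #|{: A * J}|%:R^-1 * #|X|%:R^-1 * w a x y <= eps.
Proof.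
move=> eps0 w0 w1 badP.
set c := _ * _; have c0 : 0 <= c by rewrite mulr_ge0 ?invr_ge0.
apply: (@le_trans _ _ (\sum_(a : A) \sum_(x : X) c * (#|J|%:R * eps))).
  apply: ler_sum => a _; rewrite exchange_big /=; apply: ler_sum => x _.
  (* With [j] innermost the summand is constant, so only the number of bad [j] counts. *)
  rewrite (exchange_big_dep predT) //=.
  apply: (@le_trans _ _ (\sum_y c * w a x y * (#|J|%:R * eps))).
    apply: ler_sum => y _.
    under eq_bigr do rewrite -[c * _]mulr1.
    by rewrite -mulr_sumr ler_wpM2l // mulr_ge0.
  rewrite -mulr_suml -mulr_sumr ler_wpM2r ?(mulr_ge0 _ eps0) //.
  by rewrite ler_piMr.
(* An inequality, because [0^-1 = 0] when one of the index types is empty. *)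
have divr_le1 (u : R) : u * u^-1 <= 1.
  by have [->|u0] := eqVneq u 0; rewrite ?mul0r ?ler01 // divff.
rewrite !sumr_const -mulrnA -(mulr_natl _ (_ * _)) natrM /c card_prod natrM.
set a : R := #|A|%:R; set j : R := #|J|%:R; set x : R := #|X|%:R.
have -> : x * a * ((a * j)^-1 * x^-1 * (j * eps)) =
  (a * j * (a * j)^-1) * (x * x^-1) * eps by ring.
by rewrite ler_piMl // mulr_ile1 // mulr_ge0 ?invr_ge0 ?mulr_ge0.
Qed.

Lemma sum_reindex4 (R : realType) (A J K X Y : finType) (mk : A * J -> K)
    (F : K * X * Y -> R) :
  bijective mk ->
  \sum_t F t = \sum_a \sum_j \sum_x \sum_y F (mk (a, j), x, y).
Proof.
move=> mk_bij.
rewrite (pair_bigA _ (fun a j => \sum_x \sum_y F (mk (a, j), x, y))) /=.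
transitivity (\sum_K \sum_x \sum_y F (K, x, y)).
  rewrite (pair_bigA _ (fun K x => \sum_y F (K, x, y))) /=.
  rewrite (pair_bigA _ (fun Kx y => F (Kx.1, Kx.2, y))) /=.
  by apply: eq_bigr => -[[]].
rewrite (reindex mk) /=; last exact: onW_bij.
by apply: eq_bigr => -[].
Qed.

Lemma key_of_tuple_bij s k n tau mu (Jpa Jec : finType) :
  bijective (@key_of_tuple s k n tau mu Jpa Jec).
Proof.
exists (@tuple_of_key s k n tau mu Jpa Jec); last exact: tuple_of_keyK.
by move=> [[[[[[theta r] u] d] e] jpa] jec].
Qed.

Theorem theorem2 (R : realType) (n s k tau mu : nat)
  (n_gt0 : (0 < n)%N) (s_gt0 : (0 < s)%N) (k_gt0 : (0 < k)%N)
  (tau_gt0 : (0 < tau)%N) (mu_gt0 : (0 < mu)%N) (mu_lt_s : (mu < s)%N)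
  (Jpa Jec : finType)
  (Hpa : Jpa -> bits s -> bits n) (Hpa_univ : universal2 R Hpa)
  (Hec : Jec -> bits s -> bits tau) (Hec_univ : universal2 R Hec)
  (C : {vspace bits s}) (dimC : \dim C = (s - mu)%N)
  (H : 'M['F_2]_(mu, s)) (HC : parity_check C H)
  (err : bits mu -> bits s) (err_synd : error_patterns H err)
  (Phi : {linear 'M[R[i]]_(qdim (s + k)) -> 'M[R[i]]_(qdim (s + k))})
  (Phi_cptp : cptp Phi)
  (msg : bits n) :
  let synd := syndrome H in
  let corr := syndrome_decode H err in
  let ct K x := transmit Phi (encrypt R Hpa Hec synd K msg x) in
  Pr (run_distr ct)
     (fun t : key s k n tau mu Jpa Jec * bits s * bits s =>
        let: (K, x, y) := t in
        let xhat := corrected corr K (ct K x) y in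
        (Hpa (k_pa K) x != Hpa (k_pa K) xhat) && flag_ec Hec corr K (ct K x) y)
  <= (2 ^+ tau)^-1.
Proof.
cbv zeta; set synd := syndrome H; set corr := syndrome_decode H err.
set ct := (fun _ _ => _).
(* All of the key except the index of [Hec], which is the last component of [key_of_tuple]'s
   argument. *)
pose A : finType := (Theta s k * bits k * bits n * bits tau * bits mu * Jpa)%type.
pose mk (p : A * Jec) : key s k n tau mu Jpa Jec := key_of_tuple p.
pose w (a : A) (x y : bits s) : R :=
  let: (theta, r, u, d, e, jpa) := a in
  meas_prob (zeros (val theta))
    (Phi (density (conj_coding R (merge_bits theta x r) (val theta)))) y.
pose bad (a : A) (j : Jec) (x y : bits s) :=
  let xhat := corrected corr (mk (a, j)) (ct (mk (a, j)) x) y in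
  (Hpa (k_pa (mk (a, j))) x != Hpa (k_pa (mk (a, j))) xhat) &&
  flag_ec Hec corr (mk (a, j)) (ct (mk (a, j)) x) y.
have mk_bij : bijective mk by exact: key_of_tuple_bij.
have card_key : #|{: key s k n tau mu Jpa Jec}| = #|{: A * Jec}|.
  by rewrite -(bij_eq_card mk_bij).
have eps0 : 0 <= (2 ^+ tau)^-1 :> R by rewrite invr_ge0 exprn_ge0.
rewrite /Pr big_mkcond (sum_reindex4 _ mk_bij).
rewrite [leLHS](_ : _ = \sum_a \sum_j \sum_x \sum_(y | bad a j x y)
    #|{: A * Jec}|%:R^-1 * #|{: bits s}|%:R^-1 * w a x y); last first.
  apply: eq_bigr => a _; apply: eq_bigr => j _; apply: eq_bigr => x _.
  rewrite [RHS]big_mkcond; apply: eq_bigr => y _.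
  case: a => [[[[[theta r] u] d] e] jpa].
  by rewrite /= /uniform card_key.
apply: (average_bound (w := w) (bad := bad)) => //.
- move=> [[[[[theta r] u] d] e] jpa] x y.
  apply: meas_prob_ge0 => i; apply: cp_density_diag; exact: Phi_cptp.1.
- move=> [[[[[theta r] u] d] e] jpa] x.
  by rewrite sum_meas_prob Phi_cptp.2 tr_conj_coding.
move=> [[[[[theta r] u] d] e] jpa] x y.
pose xhat := corr y (synd x).
(* Once the pads cancel, [xhat] is free of [j], so the flag is a collision at two fixed points. *)
have badE j : bad (theta, r, u, d, e, jpa) j x y =
    (Hpa jpa x != Hpa jpa xhat) && (Hec j xhat == Hec j x).
  (* Characteristic 2: adding a pad twice removes it. *)
  have addKK N (v v' : bits N) : v + v' + v' = v.
    rewrite -addrA -[RHS]addr0; congr (_ + _).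
    by apply/rowP => i; rewrite !mxE -mulr2n -mulr_natl pchar_Zp ?mul0r.
  by rewrite /bad /flag_ec /corrected /= !addKK.
under eq_bigl do rewrite badE.
(* If the [Hpa] values agree, no [j] is bad; if they differ, so do [x] and [xhat], and universality
   applies. *)
have [_|neq] := eqVneq (Hpa jpa x) (Hpa jpa xhat).
  by rewrite big_pred0_eq mulr_ge0.
have xx' : xhat != x by apply: contraNneq neq => ->.
apply: le_trans (universal2_sum Hec_univ xx') _.
by rewrite card_bits natrX.
Qed.
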